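(* Let $G$ be a group, $\mathcal C$ a category, and $\mathbf I^G\colon \mathrm{Ob}(\mathcal C^G)\sqcup \mathrm{Mor}(\mathcal C^G)\to (\mathbb R_{\ge0},\le)$ a $G$-categorical invariant. Then for any persistent $G$-objects $X_\bullet,Y_\bullet\colon(\mathbb R,\le)\to\mathcal C^G$, $$d_E^G(\mathbf I^G(X_\bullet),\mathbf I^G(Y_\bullet))\le d_I^G(X_\bullet,Y_\bullet).$$
   Context: $\mathcal C^G$ is the functor category $\mathrm{Fun}(BG,\mathcal C)$, where $BG$ is the one-object category with automorphism group $G$: objects are objects of $\mathcal C$ with a $G$-action, morphisms are $G$-equivariant morphisms. A persistent $G$-object is a functor $X_\bullet\colon(\mathbb R,\le)\to\mathcal C^G$, with structure morphisms $X_{ab}\colon X_a\to X_b$ for $a\le b$. $G$-categorical invariant: a map $\mathbf I^G\colon \mathrm{Ob}(\mathcal C^G)\sqcup \mathrm{Mor}(\mathcal C^G)\to \mathbb R_{\ge0}$ with (1) $\mathbf I^G(\mathrm{id}_X)=\mathbf I^G(X)$ for all objects $X$; (2) $\mathbf I^G(h\circ g\circ f)\le \mathbf I^G(g)$ for all composable morphisms $X\xrightarrow{f}Y\xrightarrow{g}Z\xrightarrow{h}W$. $\mathbf I^G(X_\bullet)$ is the function $[a,b]\mapsto \mathbf I^G(X_{ab})$ on closed bounded intervals of $\mathbb R$. Two such interval functions $J_1,J_2$ are $\epsilon$-eroded ($\epsilon>0$) if $J_1([a,b])\ge J_2([a-\epsilon,b+\epsilon])$ and $J_2([a,b])\ge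 J_1([a-\epsilon,b+\epsilon])$ for all $[a,b]$. The erosion distance $d_E^G(J_1,J_2)$ is the infimum of all $\epsilon>0$ for which they are $\epsilon$-eroded ($\infty$ if none). $X_\bullet,Y_\bullet$ are $G$-$\epsilon$-interleaved ($\epsilon\ge0$) if there are natural families of morphisms in $\mathcal C^G$, $\phi_t\colon X_t\to Y_{t+\epsilon}$ and $\psi_t\colon Y_t\to X_{t+\epsilon}$ ($t\in\mathbb R$), with $\psi_{t+\epsilon}\circ\phi_t=X_{t,t+2\epsilon}$ and $\phi_{t+\epsilon}\circ\psi_t=Y_{t,t+2\epsilon}$. The $G$-interleaving distance $d_I^G(X_\bullet,Y_\bullet)$ is the infimum of all $\epsilon$ for which they are $G$-$\epsilon$-interleaved ($\infty$ if none). *)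

(* Defs.v *)
From HB Require Import structures.
From mathcomp Require Import all_boot all_order all_algebra.
From mathcomp Require Import interval_inference.
From mathcomp Require Import all_classical all_reals ereal.
Set Implicit Arguments.
Unset Strict Implicit.
Unset Printing Implicit Defensive.
Import Order.TTheory GRing.Theory Num.Theory.
Local Open Scope classical_set_scope.
Local Open Scope ring_scope.

Record category := Category {
  Ob :> Type ;
  Hom : Ob -> Ob -> Type ;
  idm : forall x, Hom x x ;
  compm : forall x y z, Hom y z -> Hom x y -> Hom x z ;
  comp1m : forall x y (f : Hom x y), compm (idm y) f = f ;
  compm1 : forall x y (f : Hom x y), compm f (idm x) = f ;
  compmA : forall x y z w (h : Hom z w) (g : Hom y z) (f : Hom x y),
    compm h (compm g f) = compm (compm h g) f }.

Arguments Hom {_} _ _.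
Arguments idm {_} _.
Arguments compm {_ _ _ _} _ _.

Record functor (C D : category) := Functor {
  fobj :> C -> D ;
  fmap : forall x y : C, Hom x y -> Hom (fobj x) (fobj y) ;
  fmap1 : forall x : C, fmap (idm x) = idm (fobj x) ;
  fmapM : forall (x y z : C) (g : Hom y z) (f : Hom x y),
    fmap (compm g f) = compm (fmap g) (fmap f) }.

Arguments fmap {_ _} _ {_ _} _.

Record nattrans (C D : category) (F F' : functor C D) := NatTrans {
  component :> forall x : C, Hom (F x) (F' x) ;
  naturality : forall (x y : C) (f : Hom x y),
    compm (component y) (fmap F f) = compm (fmap F' f) (component x) }.

Lemma nattrans_eq (C D : category) (F F' : functor C D)
  (s t : nattrans F F') : (forall x, s x = t x) -> s = t.
Proof.
case: s t => [s sN] [t tN] /= st.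
have {}st : s = t by apply: functional_extensionality_dep.
by rewrite st in sN *; congr NatTrans; exact: Prop_irrelevance.
Qed.

Section functor_category.
Variables C D : category.

Program Definition nattrans_id (F : functor C D) : nattrans F F :=
  @NatTrans _ _ F F (fun x => idm (F x)) _.
Next Obligation. by move=> F x y f; rewrite comp1m compm1. Qed.

Program Definition nattrans_comp (F F' F'' : functor C D)
  (t : nattrans F' F'') (s : nattrans F F') : nattrans F F'' :=
  @NatTrans _ _ F F'' (fun x => compm (t x) (s x)) _.
Next Obligation.
by move=> F F' F'' t s x y f; rewrite -compmA naturality compmA naturality compmA.
Qed.

Program Definition functor_category : category :=
  @Category (functor C D) (@nattrans C D) nattrans_id nattrans_comp _ _ _.
Next Obligation. by move=> F F' s; apply: nattrans_eq => x; exact: comp1m. Qed.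
Next Obligation. by move=> F F' s; apply: nattrans_eq => x; exact: compm1. Qed.
Next Obligation.
by move=> F1 F2 F3 F4 u t s; apply: nattrans_eq => x; exact: compmA.
Qed.

End functor_category.

Program Definition functor_comp (B C D : category)
  (F : functor C D) (E : functor B C) : functor B D :=
  @Functor B D (fun x => F (E x)) (fun x y f => fmap F (fmap E f)) _ _.
Next Obligation. by move=> B C D F E x; rewrite /= !fmap1. Qed.
Next Obligation.
by move=> B C D F E x y z g f; rewrite /= !fmapM.
Qed.

Program Definition BG (G : groupType) : category :=
  @Category unit (fun _ _ => G) (fun _ => 1%g) (fun _ _ _ g h => (g * h)%g)
    _ _ _.
Next Obligation. by move=> G x y g; exact: mul1g. Qed.
Next Obligation. by move=> G x y g; exact: mulg1. Qed.
Next Obligation. by move=> G x y z w g h k; exact: mulgA. Qed.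

Definition G_category (G : groupType) (C : category) : category :=
  functor_category (BG G) C.

Program Definition real_category (R : realType) : category :=
  @Category R (fun a b => a <= b) (fun a => lexx a)
    (fun a b c bc ab => le_trans ab bc) _ _ _.
Next Obligation. by move=> *; exact: bool_irrelevance. Qed.
Next Obligation. by move=> *; exact: bool_irrelevance. Qed.
Next Obligation. by move=> *; exact: bool_irrelevance. Qed.

Definition persistent_object (R : realType) (D : category) :=
  functor (real_category R) D.

(* [structure_map X ab] is X_{ab} : X_a -> X_b. *)
Definition structure_map (R : realType) (D : category)
    (X : persistent_object R D) (a b : R) (ab : a <= b) :
    Hom (fobj X a) (fobj X b) :=
  @fmap _ _ X a b ab.

Record mor (D : category) := Mor {
  source : D ;
  target : D ;
  arrow :> Hom source target }.

Arguments Mor {_ _ _} _.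

Record categorical_invariant (R : realType) (D : category) := CatInvariant {
  invariant :> (Ob D + mor D)%type -> {nonneg R} ;
  invariant_id : forall X : D, invariant (inr (Mor (idm X))) = invariant (inl X) ;
  invariant_comp : forall (X Y Z W : D)
      (f : Hom X Y) (g : Hom Y Z) (h : Hom Z W),
    invariant (inr (Mor (compm h (compm g f)))) <= invariant (inr (Mor g)) }.

(* Closed bounded intervals [a, b]; the degenerate case a = b is allowed. *)
Record cbinterval (R : realType) := CBInterval {
  left_end : R ;
  right_end : R ;
  left_le_right : left_end <= right_end }.

Definition interval_function (R : realType) := cbinterval R -> {nonneg R}.

Definition persistent_invariant (R : realType) (D : category)
    (I : categorical_invariant R D) (X : persistent_object R D) :
    interval_function R :=
  fun ab => I (inr (Mor (structure_map X (left_le_right ab)))).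

Lemma thicken_subproof (R : realType) (ab : cbinterval R) (e : R) :
  0 < e -> left_end ab - e <= right_end ab + e.
Proof.
move=> e0; apply: lerD; first exact: left_le_right.
by rewrite -subr_ge0 opprK addr_ge0 // ltW.
Qed.

Definition thicken (R : realType) (e : R) (e0 : 0 < e) (ab : cbinterval R) :
    cbinterval R :=
  CBInterval (thicken_subproof ab e0).

Definition eroded (R : realType) (J1 J2 : interval_function R)
    (e : R) (e0 : 0 < e) : Prop :=
  forall ab, J1 ab >= J2 (thicken e0 ab) /\ J2 ab >= J1 (thicken e0 ab).

(* The infimum is taken in the extended reals, where [ereal_inf set0 = +oo]. *)
Definition erosion_distance (R : realType) (J1 J2 : interval_function R) :
    \bar R :=
  ereal_inf [set e%:E | e in [set e : R | exists e0 : 0 < e, eroded J1 J2 e0]].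

Program Definition shift (R : realType) (e : R) :
    functor (real_category R) (real_category R) :=
  @Functor (real_category R) (real_category R) (fun t : R => t + e)
    (fun a b ab => lerD ab (lexx e)) _ _.
Next Obligation. by move=> *; exact: bool_irrelevance. Qed.
Next Obligation. by move=> *; exact: bool_irrelevance. Qed.

Lemma le_add2eps (R : realType) (e t : R) : 0 <= e -> t <= t + e + e.
Proof. by move=> e0; rewrite -addrA lerDl addr_ge0. Qed.

(* The index t + 2e is written t + e + e, so that the composites
   [psi (t + e) o phi t] and the structure maps have the same type. *)
Definition interleaved (R : realType) (D : category)
    (X Y : persistent_object R D) (e : R) (e0 : 0 <= e) : Prop :=
  exists (phi : nattrans X (functor_comp Y (shift e)))
         (psi : nattrans Y (functor_comp X (shift e))),
    forall t : R,
      compm (psi (t + e)) (phi t) = structure_map X (le_add2eps t e0) /\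
      compm (phi (t + e)) (psi t) = structure_map Y (le_add2eps t e0).

Definition interleaving_distance (R : realType) (D : category)
    (X Y : persistent_object R D) : \bar R :=
  ereal_inf
    [set e%:E | e in [set e : R | exists e0 : 0 <= e, interleaved X Y e0]].

(* Main.v *)
(* An epsilon-interleaving factors Y_{a-e,b+e} through X_{ab} as
   Y_{a-e} -> Y_{a-eps} -> X_a -> X_b -> Y_{b+eps} -> Y_{b+e} for every
   e >= eps, so I(Y_{a-e,b+e}) <= I(X_{ab}), and symmetrically. Letting e be
   larger than eps also covers eps = 0, for which erosion is not defined. *)
Require Import Defs.
From mathcomp Require Import all_boot all_order all_algebra.
From mathcomp Require Import all_classical all_reals ereal.
Set Implicit Arguments.
Unset Strict Implicit.
Unset Printing Implicit Defensive.
Import Order.TTheory GRing.Theory Num.Theory.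
Local Open Scope classical_set_scope.
Local Open Scope ring_scope.

(** Functoriality yields only the proof term [le_trans ab bc]. Since proofs of a boolean inequality
    are unique, any [ac] will do, so structure maps can be merged by rewriting. *)
Lemma structure_map_comp (R : realType) (D : category)
    (X : persistent_object R D) (a b c : R)
    (bc : b <= c) (ab : a <= b) (ac : a <= c) :
  compm (structure_map X bc) (structure_map X ab) = structure_map X ac.
Proof.
rewrite /structure_map -fmapM.
exact: (congr1 (@structure_map R D X a c) (bool_irrelevance (le_trans ab bc) ac)).
Qed.

Lemma interleaved_sym (R : realType) (D : category)
    (X Y : persistent_object R D) (d : R) (d0 : 0 <= d) :
  interleaved X Y d0 -> interleaved Y X d0.
Proof. by move=> [phi [psi H]]; exists psi, phi => t; have [] := H t. Qed.

Lemma interleaved_invariant_le (R : realType) (D : category)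
    (I : categorical_invariant R D) (X Y : persistent_object R D)
    (d e : R) (d0 : 0 <= d) (e0 : 0 < e) (ab : cbinterval R) :
  d <= e -> interleaved X Y d0 ->
  persistent_invariant I Y (thicken e0 ab) <= persistent_invariant I X ab.
Proof.
case: ab => a b ab de [phi [psi H]]; rewrite /persistent_invariant /=.
set Yab := structure_map Y _; set Xab := structure_map X _.
have ae : a - e <= a - d by rewrite lerD2l lerN2.
(* X (a - d + d) and X a are equal only propositionally: a structure map
   replaces the cast. *)
have ad : a - d + d <= a by rewrite subrK.
have be : b + d <= b + e by rewrite lerD2l.
have adb : a - d + d <= b := le_trans ad ab.
have addb : a - d + d + d <= b + d by rewrite lerD2r.
pose f := compm (structure_map X ad) (compm (psi (a - d)) (structure_map Y ae)).
pose h := compm (structure_map Y be) (phi b).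
(* The second invariant axiom applies with [Xab] as the middle morphism. *)
suff -> : Yab = compm h (compm Xab f) by exact: Defs.invariant_comp.
(* Naturality moves [phi] from [b] back to [a - d + d], next to [psi (a - d)], where the
   interleaving identity turns the pair into a structure map of [Y]. *)
have phi_nat : compm (phi b) (structure_map X adb) =
    compm (structure_map Y addb) (phi (a - d + d)).
  rewrite (naturality phi (x := a - d + d) (y := b) adb) /=.
  congr compm.
  exact: (congr1 (structure_map Y (b := b + d)) (bool_irrelevance _ addb)).
have [_ phipsi] := H (a - d).
rewrite /h /f (compmA Xab) (structure_map_comp X _ _ adb) -compmA.
rewrite (compmA (phi b)) phi_nat -compmA (compmA (phi _)) phipsi.
(* Only structure maps of [Y] remain; they compose to [Yab]. *)
have ad2 : a - e <= a - d + d + d := le_trans ae (le_add2eps (a - d) d0).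
have adb2 : a - e <= b + d := le_trans ad2 addb.
rewrite (structure_map_comp Y _ _ ad2) (structure_map_comp Y _ _ adb2).
exact: esym (structure_map_comp _ _ _ _).
Qed.

Lemma interleaved_eroded (R : realType) (D : category)
    (I : categorical_invariant R D) (X Y : persistent_object R D)
    (d e : R) (d0 : 0 <= d) (e0 : 0 < e) :
  d <= e -> interleaved X Y d0 ->
  eroded (persistent_invariant I X) (persistent_invariant I Y) e0.
Proof.
move=> de XY ab; split; first exact: interleaved_invariant_le XY.
exact: interleaved_invariant_le (interleaved_sym XY).
Qed.

Theorem theorem5p7 (R : realType) (G : groupType) (C : category)
    (I : categorical_invariant R (G_category G C))
    (X Y : persistent_object R (G_category G C)) :
  (erosion_distance (persistent_invariant I X) (persistent_invariant I Y)
     <= interleaving_distance X Y)%E.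
Proof.
apply: le_ereal_inf_tmp => _ [d [d0 XY] <-].
(* The slack [r] makes [d + r] a positive erosion parameter above [d]. *)
apply/lee_addgt0Pr => r r0; apply: ereal_inf_lbound.
exists (d + r) => //; exists (ltr_wpDl d0 r0).
by apply: interleaved_eroded XY; rewrite lerDl ltW.
Qed.
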